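(* For every fixed integer $k\ge 1$, as $n\to\infty$, $$f(n, C_{4k+2}) \leq (1+o(1))\frac{1}{\sqrt 2}\, n2^{n-1}.$$
   Context: $Q_n$ is the $n$-dimensional hypercube: the graph whose vertices are the binary sequences of length $n$, two being adjacent if and only if they differ in exactly one position (so $|E(Q_n)|=n2^{n-1}$). $C_l$ denotes a cycle of length $l$, and $f(n,C_l)$ denotes the largest number of edges in a subgraph of $Q_n$ containing no cycle of length $l$ (as a not necessarily induced subgraph). The $o(1)$ term tends to $0$ as $n\to\infty$ with $k$ fixed. *)

(* Defs.v *)
From mathcomp Require Import all_boot.

Set Implicit Arguments.
Unset Strict Implicit.
Unset Printing Implicit Defensive.

Definition cube_adj (n : nat) : rel (n.-tuple bool) :=
  fun x y => #|[set i : 'I_n | tnth x i != tnth y i]| == 1.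

Definition cube_edges (n : nat) : {set {set n.-tuple bool}} :=
  [set e | [exists x, exists y, cube_adj x y && (e == [set x; y])]].

(* Graphs are given by their edge sets.  The guard [2 < l] is needed because
   [ucycleb] also accepts an edge traversed back and forth, and the empty
   sequence. *)
Definition has_cycle (T : finType) (F : {set {set T}}) (l : nat) : bool :=
  (2 < l) &&
  [exists c : l.-tuple T, ucycleb (fun x y => [set x; y] \in F) c].

(* Isolated vertices affect neither the number of edges nor the cycles, so
   subgraphs of the cube are represented by sets of edges of the cube. *)
Definition ex_cube (n l : nat) : nat :=
  \max_(F : {set {set n.-tuple bool}} |
        (F \subset cube_edges n) && ~~ has_cycle F l) #|F|.

(* Main.v *)
Require Import Defs.
From mathcomp Require Import all_boot all_order all_algebra.
From mathcomp Require Import all_classical all_reals all_analysis.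
(* [finset] comes after the analysis files so that [set0], [setT] and the
   lemmas on them refer to finite sets. *)
From mathcomp Require Import fintype finset zify ring lra.
Import Order.TTheory GRing.Theory Num.Theory.
Import numFieldNormedType.Exports.

(** Write x + i for the vertex x of the cube with coordinate i flipped.  Given
    a set F of edges, attach to each vertex x its link: the graph on the
    coordinates in which i and j are adjacent when the path
    x + i, x + i + j, x + j runs in F.  Concatenating these paths along a cycle
    of length l = 2k+1 >= 3 of the link gives a cycle of length 2l = 4k+2 in F
    ([link_cycle]), so if F has no cycle of length 4k+2, then no link has a
    cycle of length l.

    A graph on n vertices without a given odd cycle has at most n^2/4 + O(n)
    edges ([cycle_free_arcs]).  In fact, when every degree is at least
    (n + l)/2, any two vertices have at least l common neighbours, and a greedy
    path on l - 1 vertices closes up through one of them ([dense_cycle]);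
    otherwise delete a vertex of small degree and induct.

    A path of two edges of F centred at y and using the directions i and j is an
    edge ij of the link of x = y + i + j, and conversely.  Hence the links have
    in total sum_y d(y)(d(y) - 1) arcs, d(y) being the degree of y in F
    ([link_arcs_sum]), and this is at most 2^n (n^2/2 + O(n)).  By
    Cauchy-Schwarz the average of d is at most (1 + O(1/n)) n / sqrt 2, which
    is the bound on the number of edges. *)

(** * Two general facts *)

(** The default value [w] of [nth] closes the cycle: position [size (w :: p)]
    is again the starting point, so the wrap-around needs no separate case. *)
Lemma cycle_nthP (T : eqType) (e : rel T) (w : T) (p : seq T) :
  reflect (forall t, t < (size p).+1 ->
             e (nth w (w :: p) t) (nth w (w :: p) t.+1))
          (cycle e (w :: p)).
Proof.
have nthE t : nth w (rcons p w) t = nth w p t.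
  rewrite nth_rcons; case: ltngtP => // [lt_p|->]; last by rewrite nth_default.
  by rewrite nth_default // ltnW.
apply: (iffP (pathP w)); rewrite size_rcons => H t lt_t; have := H t lt_t.
  by rewrite -rcons_cons nth_rcons /= lt_t nthE.
by rewrite -rcons_cons nth_rcons /= lt_t nthE.
Qed.

Lemma Cauchy_Schwarz_card (I : finType) (d : I -> nat) :
  (\sum_i d i) ^ 2 <= #|I| * \sum_i d i ^ 2.
Proof.
rewrite -(leq_pmul2l (ltn0Sn 1)).
have -> : 2 * (\sum_i d i) ^ 2 = \sum_i \sum_j 2 * (d i * d j).
  rewrite expnS expn1 big_distrl big_distrr /=; apply: eq_bigr => i _.
  by rewrite !big_distrr.
have -> : 2 * (#|I| * \sum_i d i ^ 2) = \sum_i \sum_j (d i ^ 2 + d j ^ 2).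
  under [RHS]eq_bigr => i _ do rewrite big_split /= sum_nat_const.
  rewrite big_split /= -big_distrr /= sum_nat_const -mulnDr addnn.
  by rewrite mul2n doubleMr.
apply: leq_sum => i _; apply: leq_sum => j _.
by apply: (nat_Cauchy (d i) (d j)).
Qed.

(** * Edges of a graph without a cycle of given length *)

Section SparseGraphs.

Variables (T : finType) (e : rel T).
Hypotheses (e_sym : symmetric e) (e_irr : irreflexive e).

Definition degree_in (A : {set T}) (x : T) : nat := #|[set y in A | e x y]|.
(** Every edge inside [A] is counted twice, once per orientation. *)
Definition arcs_in (A : {set T}) : nat := \sum_(x in A) degree_in A x.

Lemma degree_inE (A : {set T}) x : degree_in A x = \sum_(y in A) e x y.
Proof. by rewrite /degree_in -sum1dep_card big_mkcondr. Qed.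

Lemma arcs_in_delete (A : {set T}) v :
  v \in A -> arcs_in A = arcs_in (A :\ v) + 2 * degree_in A v.
Proof.
move=> vA; rewrite /arcs_in (big_setD1 v) //=.
have -> : \sum_(x in A :\ v) degree_in A x =
          \sum_(x in A :\ v) degree_in (A :\ v) x + \sum_(x in A :\ v) e v x.
  rewrite -big_split; apply: eq_bigr => x _ /=.
  by rewrite !degree_inE (big_setD1 v) //= e_sym addnC.
rewrite [degree_in A v in RHS]degree_inE (big_setD1 v vA) /= e_irr.
by rewrite degree_inE (big_setD1 v vA) /= e_irr; lia.
Qed.

(** The current end [x] has at least [m] neighbours in [A], none of them [x];
    as long as the rest of the path has fewer than [m] vertices, one of these
    neighbours is new. *)
Lemma greedy_path (A : {set T}) m :
    (forall x, x \in A -> m <= degree_in A x) -> A != set0 ->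
  exists x p, [/\ size p = m, path e x p, uniq (x :: p) &
                  {subset x :: p <= A}].
Proof.
move=> degA /set0Pn[x0 x0A].
suff H s : s <= m -> exists x p, [/\ size p = s, path e x p, uniq (x :: p) &
                  {subset x :: p <= A}] by apply: H.
elim: s => [_|s IHs lt_sm].
  by exists x0, [::]; split=> // x; rewrite inE => /eqP->.
have [x [p [sz_p pth uq sub]]] := IHs (ltnW lt_sm).
have xA : x \in A by apply: sub; rewrite mem_head.
have /subsetPn[y] : ~~ ([set y in A | e x y] \subset [set y in p]).
  apply/negP => /subset_leq_card; apply/negP; rewrite -ltnNge.
  apply: leq_trans (degA x xA); rewrite cardsE.
  by apply: leq_ltn_trans (card_size p) _; rewrite sz_p.
rewrite !inE => /andP[yA exy] yp.
exists y, (x :: p); split; rewrite /= ?sz_p //.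
- by rewrite e_sym exy.
- rewrite inE negb_or yp -/(uniq (x :: p)) uq !andbT.
  by apply: contraTneq exy => ->; rewrite e_irr.
- by move=> z; rewrite inE => /predU1P[->|/sub].
Qed.

(** Two vertices of [A] have at least [2 * degree - #|A| >= l] common neighbours
    in [A], so the ends of a greedy path on [l - 1] vertices have one off the
    path. *)
Lemma dense_cycle (A : {set T}) l :
    1 < l -> A != set0 ->
    (forall x, x \in A -> #|A| + l <= 2 * degree_in A x) ->
  exists c, [/\ size c = l, cycle e c & uniq c].
Proof.
move=> l_gt1 A0 degA.
have leA x : degree_in A x <= #|A|.
  by apply: subset_leq_card; apply/subsetP=> y; rewrite inE => /andP[].
have [x [p [sz_p pth uq sub]]] : exists x p,
    [/\ size p = l.-2, path e x p, uniq (x :: p) & {subset x :: p <= A}].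
  apply: greedy_path => // x /degA; have := leA x; lia.
have xA : x \in A by apply: sub; rewrite mem_head.
have yA : last x p \in A by apply: sub; rewrite mem_last.
have /subsetPn[w] : ~~ ([set z in A | e x z] :&: [set z in A | e (last x p) z]
                          \subset [set z in x :: p]).
  apply/negP => /subset_leq_card; apply/negP; rewrite -ltnNge.
  have lt_p : #|[set z in x :: p]| < l.
    rewrite cardsE; apply: leq_ltn_trans (card_size _) _; rewrite /= sz_p; lia.
  have := cardsUI [set z in A | e x z] [set z in A | e (last x p) z].
  have : #|[set z in A | e x z] :|: [set z in A | e (last x p) z]| <= #|A|.
    apply: subset_leq_card; apply/subsetP=> y.
    by rewrite !inE -andb_orr => /andP[].
  have := degA _ xA; have := degA _ yA; rewrite /degree_in; lia.
rewrite !inE => /andP[/andP[_ exw] /andP[_ eyw]] w_new.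
exists (w :: x :: p); split; first by rewrite /= sz_p; lia.
  by rewrite /= rcons_path pth eyw e_sym exw.
by rewrite [uniq _]/= inE w_new.
Qed.

(** By [dense_cycle] some vertex has degree less than [(#|A| + l) / 2]; deleting
    it lowers [2 * arcs_in A] by at most [2 * (#|A| + l - 1)], while the right
    hand side drops by [2 * #|A| - 1 + 2 * l]. *)
Lemma cycle_free_arcs l (A : {set T}) :
    1 < l -> (forall c, size c = l -> ~~ (cycle e c && uniq c)) ->
  2 * arcs_in A <= #|A| ^ 2 + 2 * l * #|A|.
Proof.
move=> l_gt1 no_cyc; have [m] := ubnP #|A|; elim: m A => // m IHm A ltAm.
have [->|A0] := eqVneq A set0; first by rewrite /arcs_in big_set0.
have [/existsP[v /andP[vA low]]|] :=
    boolP [exists x, (x \in A) && (2 * degree_in A x < #|A| + l)].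
  have cA : #|A| = (#|A :\ v|).+1 by rewrite (cardsD1 v) vA.
  have := IHm (A :\ v) _; rewrite -ltnS -cA ltAm => /(_ isT).
  rewrite (arcs_in_delete _ _ vA); move: low; rewrite cA; nia.
rewrite negb_exists => /forallP high.
have [||c [sz cyc uq]] := dense_cycle A l _ A0; first by [].
  by move=> x xA; have := high x; rewrite xA /= -leqNgt.
by have := no_cyc c sz; rewrite cyc uq.
Qed.

End SparseGraphs.

(** * Links of the vertices of the cube *)

Section Cube.

Variable n : nat.
Implicit Types (x y : n.-tuple bool) (i j : 'I_n).
Implicit Types (F : {set {set n.-tuple bool}}).

Definition flip i x : n.-tuple bool := [tuple tnth x j (+) (j == i) | j < n].

Lemma tnth_flip i x j : tnth (flip i x) j = tnth x j (+) (j == i).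
Proof. by rewrite tnth_mktuple. Qed.

Lemma flipK i : involutive (flip i).
Proof. by move=> x; apply: eq_from_tnth => j; rewrite !tnth_flip addbK. Qed.

Lemma flipC i j x : flip i (flip j x) = flip j (flip i x).
Proof. by apply: eq_from_tnth => t; rewrite !tnth_flip addbAC. Qed.

Definition flipped x y : {set 'I_n} := [set i | tnth x i != tnth y i].

Lemma flipped1 i x : flipped x (flip i x) = [set i].
Proof.
by apply/setP => j; rewrite !inE tnth_flip; case: (tnth _ _) (j == i) => [] [].
Qed.

Lemma flipped2 i j x : i != j -> flipped x (flip i (flip j x)) = [set i; j].
Proof.
move=> neq; apply/setP => t; rewrite !inE !tnth_flip.
have [->|_] := eqVneq t i; first by rewrite (negPf neq); case: (tnth _ _).
by case: (tnth _ _) (t == j) => [] [].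
Qed.

Lemma cube_adjP x y : reflect (exists i, y = flip i x) (cube_adj x y).
Proof.
apply: (iffP cards1P) => [[i Hi]|[i ->]]; exists i; last exact: flipped1.
apply: eq_from_tnth => j; rewrite tnth_flip.
move/setP/(_ j): Hi; rewrite !inE.
by case: (tnth x j) (tnth y j) (j == i) => [] [] [].
Qed.

(** The common neighbours of [flip i x] and [flip j x] are [x] and the vertex
    used here, opposite to [x]; with the latter, each path of two edges of [F]
    comes from the link of a single vertex. *)
Definition link F x : rel 'I_n := fun i j =>
  [&& i != j, [set flip i x; flip i (flip j x)] \in F
            & [set flip j x; flip i (flip j x)] \in F].

Lemma link_sym F x : symmetric (link F x).
Proof.
by move=> i j; rewrite /link eq_sym (flipC i j) andbA andbAC -andbA.
Qed.

Lemma link_irr F x : irreflexive (link F x).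
Proof. by move=> i; rewrite /link eqxx. Qed.

(** Along a cycle a_0, a_1, ... of the link, the cycle of the cube is
    x + a_0, x + a_0 + a_1, x + a_1, x + a_1 + a_2, ... .  Its vertices differ
    from x in the sets {a_t} and {a_t, a_(t+1)}; the vertices and the edges of a
    cycle of length at least 3 being distinct, so are these sets. *)
Lemma link_cycle F x (c : seq 'I_n) :
  2 < size c -> cycle (link F x) c -> uniq c -> has_cycle F (2 * size c).
Proof.
case: c => // w p; set c := w :: p; set l := size c.
move=> l_gt2 /cycle_nthP step uq.
pose a t := nth w c t.
have a_l : a l = a 0 by rewrite /a nth_default.
have a_inj s t : s < l -> t < l -> a s = a t -> s = t.
  by move=> ls lt /eqP; rewrite nth_uniq // => /eqP.
(* The index [t.+1] may be [l], where [a] is back at its initial value. *)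
have a_inj' s t : s < l -> t < l -> a s = a t.+1 ->
    s = t.+1 \/ s = 0 /\ t.+1 = l.
  move=> ls; rewrite leq_eqVlt => /predU1P[->|lt /(a_inj _ _ ls lt)]; last by left.
  by rewrite a_l => /a_inj H; right; split=> //; apply: H; lia.
pose g t := if odd t then flip (a t./2) (flip (a t./2.+1) x)
            else flip (a t./2) x.
have a_step t : t < l -> link F x (a t) (a t.+1) by apply: step.
have g_step t : t < 2 * l -> [set g t; g t.+1] \in F.
  move=> lt_t; have /a_step/and3P[_ e1 e2] : t./2 < l by lia.
  rewrite /g /= uphalf_half; case: (odd t) => /=; rewrite ?add0n ?add1n //.
  by rewrite setUC.
have g_per : g (2 * l) = g 0 by rewrite /g mul2n odd_double doubleK /= a_l.
have fg t : t < 2 * l -> flipped x (g t) =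
    if odd t then [set a t./2; a t./2.+1] else [set a t./2].
  move=> lt_t; rewrite /g; case: ifP => _; last exact: flipped1.
  by apply: flipped2; have /a_step/and3P[] : t./2 < l by lia.
have ne t : t < 2 * l -> a t./2 != a t./2.+1.
  by move=> lt_t; have /a_step/and3P[] : t./2 < l by lia.
have g_inj : {in gtn (2 * l) &, injective g}.
  move=> s t; rewrite !inE => ls lt /(congr1 (flipped x)); rewrite !fg //.
  have hs : s./2 < l by lia.
  have ht : t./2 < l by lia.
  have es := odd_double_half s; have et := odd_double_half t.
  case: ifP => os; case: ifP => ot eq_st.
  (* If {a_u, a_(u+1)} = {a_v, a_(v+1)} with u = s./2 and v = t./2 distinct,
     then u and v are cyclic successors of each other, which is impossible for
     2 < l. *)
  - suff : s./2 = t./2 by move: es et; rewrite os ot; lia.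
    have := set21 (a s./2) (a s./2.+1); rewrite eq_st in_set2.
    case/orP => /eqP; first exact: a_inj.
    move/(a_inj' _ _ hs ht) => H1.
    have := set21 (a t./2) (a t./2.+1); rewrite -eq_st in_set2.
    case/orP => /eqP; first by move/(a_inj _ _ ht hs) ->.
    move/(a_inj' _ _ ht hs) => H2; lia.
  - have := congr1 (fun B : {set _} => #|B|) eq_st.
    by rewrite /= cards2 ne // cards1.
  - have := congr1 (fun B : {set _} => #|B|) eq_st.
    by rewrite /= cards2 ne // cards1.
  - suff : s./2 = t./2 by move: es et; rewrite os ot; lia.
    by apply: a_inj => //; apply: set1_inj.
have sz : size (mkseq g (2 * l)) == 2 * l by rewrite size_mkseq.
rewrite /has_cycle; apply/andP; split; first by lia.
apply/existsP; exists (Tuple sz).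
suff cyc : cycle (fun x y => [set x; y] \in F) (mkseq g (2 * l)).
  by apply/andP; split; [exact: cyc | exact: (introT (mkseq_uniqP _ _) g_inj)].
have gE t : t < 2 * l -> nth (g 0) (mkseq g (2 * l)) t = g t by apply: nth_mkseq.
case E: (mkseq g (2 * l)) => [//|u q].
have szq : (size q).+1 = 2 * l by rewrite -(eqP sz) E.
have u0 : u = g 0 by have := gE 0; rewrite E /= => -> //; lia.
rewrite u0 in E *; apply/cycle_nthP; rewrite szq => t lt_t; rewrite -E gE //.
move: (lt_t); rewrite leq_eqVlt => /predU1P[eq_t|lt_t1].
  by rewrite [nth _ _ t.+1]nth_default ?(eqP sz) ?eq_t // -g_per -eq_t g_step.
by rewrite gE // g_step.
Qed.

Definition cube_degree F y : nat := #|[set i | [set y; flip i y] \in F]|.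

Lemma cube_degree_sum F :
  F \subset cube_edges n -> 2 * #|F| <= \sum_y cube_degree F y.
Proof.
move=> /subsetP sF.
have edgeP E : E \in F -> exists x i, E = [set x; flip i x].
  move/sF; rewrite inE => /existsP[x /existsP[y /andP[/cube_adjP[i ->] /eqP->]]].
  by exists x, i.
have -> : 2 * #|F| = \sum_(E in F) \sum_y (y \in E).
  rewrite mulnC -sum_nat_const; apply: eq_bigr => E /edgeP[x [i ->]].
  rewrite -big_mkcond sum1_card cards2.
  suff -> : x != flip i x by [].
  apply/eqP => /(congr1 (fun y => tnth y i)); rewrite tnth_flip eqxx.
  by case: (tnth _ _).
rewrite exchange_big /=; apply: leq_sum => y _.
rewrite -big_mkcondr sum1dep_card.
apply: leq_trans (leq_imset_card (fun i => [set y; flip i y]) _).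
apply: subset_leq_card; apply/subsetP => E; rewrite !inE => /andP[EF].
case/edgeP: (EF) => x [i eqE]; rewrite eqE in_set2.
move=> yE; suff eqEy : E = [set y; flip i y].
  by apply/imsetP; exists i; rewrite ?inE -?eqE -?eqEy.
by case/orP: yE eqE => /eqP -> //; rewrite flipK setUC.
Qed.

(** An arc (i, j) of the link of [x] is an ordered pair of distinct edges of [F]
    at [y = flip i (flip j x)]; for fixed i and j, [x] and [y] determine each
    other. *)
Lemma link_arcs_sum F :
  \sum_x arcs_in _ (link F x) [set: 'I_n] + \sum_y cube_degree F y =
  \sum_y cube_degree F y ^ 2.
Proof.
pose E y i : bool := [set y; flip i y] \in F.
have degE y : cube_degree F y = \sum_i E y i.
  by rewrite /cube_degree -sum1dep_card big_mkcond.
have -> : \sum_x arcs_in _ (link F x) [set: 'I_n] =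
          \sum_y \sum_i \sum_(j | j != i) E y i * E y j.
  transitivity (\sum_i \sum_(j | j != i) \sum_x link F x i j).
    rewrite (eq_bigr (fun x => \sum_i \sum_(j | j != i) link F x i j)).
      rewrite exchange_big; apply: eq_bigr => i _; exact: exchange_big.
    move=> x _; apply: eq_big => [i|i _]; first by rewrite in_setT.
    rewrite degree_inE (bigD1 i) ?in_setT //= link_irr add0n.
    by apply: eq_bigl => j; rewrite in_setT.
  rewrite [RHS]exchange_big; apply: eq_bigr => i _.
  rewrite [RHS]exchange_big; apply: eq_bigr => j ji /=.
  rewrite (reindex_inj (inj_comp (inv_inj (flipK i)) (inv_inj (flipK j)))) /=.
  apply: eq_bigr => y _; rewrite /link eq_sym ji /= /E mulnb.
  have -> : flip i (flip j (flip i (flip j y))) = y.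
    by rewrite (flipC j i) flipK flipK.
  by rewrite flipK (flipC i j) flipK !(setUC [set y]) andbC.
rewrite -big_split; apply: eq_bigr => y _ /=; rewrite degE expnS expn1.
rewrite -big_split big_distrl; apply: eq_bigr => i _ /=.
rewrite big_distrr [RHS](bigD1 i) //= addnC.
by congr (_ + _); rewrite mulnb andbb.
Qed.

(** With S the sum of the degrees, so that 2|F| <= S <= n 2^n, Cauchy-Schwarz
    gives S^2 <= 2^n (arcs of all links + S). *)
Lemma cube_edges_bound F l :
    2 < l -> F \subset cube_edges n -> ~~ has_cycle F (2 * l) ->
  8 * #|F| ^ 2 <= (2 ^ n) ^ 2 * (n ^ 2 + (2 * l + 2) * n).
Proof.
move=> l_gt2 /cube_degree_sum F_le no_cyc.
have cardV : #|{: n.-tuple bool}| = 2 ^ n by rewrite card_tuple card_bool.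
have arcs_le x : 2 * arcs_in _ (link F x) [set: 'I_n] <= n ^ 2 + 2 * l * n.
  have := @cycle_free_arcs _ _ (link_sym F x) (link_irr F x) l [set: 'I_n].
  rewrite cardsT card_ord; apply; first exact: ltnW.
  move=> c sz_c; apply: contra no_cyc => /andP[cyc uq].
  by rewrite -sz_c; apply: (link_cycle F x) => //; rewrite sz_c.
have deg_le : \sum_y cube_degree F y <= 2 ^ n * n.
  rewrite -cardV -sum_nat_const; apply: leq_sum => y _.
  by rewrite -[leqRHS]card_ord max_card.
have arcs_sum_le :
    2 * \sum_x arcs_in _ (link F x) [set: 'I_n] <= 2 ^ n * (n ^ 2 + 2 * l * n).
  rewrite -cardV -sum_nat_const big_distrr.
  by apply: leq_sum => x _; apply: arcs_le.
have := Cauchy_Schwarz_card _ (cube_degree F); rewrite cardV -link_arcs_sum.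
nia.
Qed.

Lemma ex_cube_bound l : 2 < l ->
  2 * ex_cube n (2 * l) ^ 2 <= (2 ^ n.-1) ^ 2 * (n ^ 2 + (2 * l + 2) * n).
Proof.
move=> l_gt2; apply: (big_ind (fun m =>
  2 * m ^ 2 <= (2 ^ n.-1) ^ 2 * (n ^ 2 + (2 * l + 2) * n))) => [//||F].
  by move=> a b; rewrite /maxn; case: ifP.
move=> /andP[sF /(cube_edges_bound F l l_gt2 sF)].
move: #|F| => m; case: n => [|n'] /=; rewrite ?expnS; nia.
Qed.

End Cube.

(** * The asymptotic bound *)

Local Open Scope classical_set_scope.
Local Open Scope ring_scope.

Theorem theorem3p3 (R : realType) (k : nat) (hk : (1 <= k)%N) :
  exists eps : nat -> R,
    (eps n @[n --> \oo] --> (0 : R)) /\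
    (forall n : nat,
       (ex_cube n (4 * k + 2))%:R
         <= (1 + eps n) * (1 / Num.sqrt 2) * (n * 2 ^ n.-1)%:R :> R).
Proof.
pose C : nat := (4 * k + 4)%N.
exists (fun n => C%:R * harmonic n); split.
  rewrite -[X in _ --> X](mulr0 C%:R); apply: cvgMl_tmp; exact: cvg_harmonic.
move=> n; cbv beta; have -> : (4 * k + 2 = 2 * (2 * k + 1))%N by lia.
have := ex_cube_bound n (2 * k + 1)%N.
have -> : (2 * (2 * k + 1) + 2 = C)%N by rewrite /C; lia.
have l_gt2 : (2 < 2 * k + 1)%N by lia.
move=> /(_ l_gt2); move: (ex_cube _ _) (2 ^ n.-1)%N => f P.
rewrite -(ler_nat R) !natrM natrD natrM !natrX => bound.
set eps := C%:R * harmonic n; set s : R := Num.sqrt 2.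
have s2 : s ^+ 2 = 2 by rewrite sqr_sqrtr.
have s_gt0 : 0 < s by rewrite sqrtr_gt0.
have epsE : eps * (n%:R + 1) = C%:R.
  by rewrite /eps /= -natr1 mulfVK // natr1 pnatr_eq0.
have eps_ge0 : 0 <= eps by rewrite mulr_ge0 ?invr_ge0 ?ler0n.
have N_le : n%:R <= n%:R ^+ 2 :> R by rewrite -natrX ler_nat; nia.
(* Since (1 + eps)^2 >= 1 + 2 eps and 2 n >= n + 1 unless n = 0. *)
have key : n%:R ^+ 2 + C%:R * n%:R <= ((1 + eps) * n%:R) ^+ 2 :> R.
  rewrite -epsE; nra.
have -> : (1 + eps) * (1 / s) * (n%:R * P%:R) = (1 + eps) * n%:R * P%:R / s.
  by field; rewrite gt_eqF.
rewrite ler_pdivlMr // -(@ler_pXn2r _ 2) //;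
  rewrite ?nnegrE ?mulr_ge0 ?addr_ge0 ?ler0n ?(ltW s_gt0) //.
rewrite exprMn s2 mulrC [leRHS]exprMn (le_trans bound) // mulrC.
by rewrite ler_wpM2r ?exprn_ge0.
Qed.
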